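(* Let $z\in\mathbb C\cup\{\infty\}$ and assume $z\notin\mathbb Z$. Then the distinguished vector $\xi_0$ is a cyclic vector of the representation $T_z$ of $G$.
   Context: $S(n)$ is the group of permutations of $\{1,\dots,n\}$, identified with the stabilizer of $n+1$ in $S(n+1)$; $S(\infty)=\bigcup_n S(n)$; $G=S(\infty)\times S(\infty)$, $G(n)=S(n)\times S(n)$. The canonical projection $p_{n,n+1}:S(n+1)\to S(n)$ removes $n+1$ from its cycle: for $1\le i\le n$, $(p_{n,n+1}(x))(i)=x(i)$ if $x(i)\le n$, and $=x(n+1)$ if $x(i)=n+1$. $H^n=L^2(S(n))$ with respect to the uniform probability measure; $\mathrm{Reg}^n$ is the representation of $G(n)$ in $H^n$, $(\mathrm{Reg}^n(g)f)(x)=f(g_2^{-1}xg_1)$. For $z\in\mathbb C$, $t=|z|^2$, the isometric $G(n)$-equivariant embedding $L_z^n:H^n\to H^{n+1}$ is $(L_z^nf)(x)=z\sqrt{\frac{n+1}{t+n}}f(x)$ for $x\in S(n)$ and $(L_z^nf)(x)=\sqrt{\frac{n+1}{t+n}}f(p_{n,n+1}(x))$ for $x\in S(n+1)\setminus S(n)$; for $z=\infty$, $(L_\infty^nf)(x)=\sqrt{n+1}\,f(x)$ for $x\in S(n)$ and $0$ otherwise. The generalized regular representation $T_z$ of $G$ is the inductive limit of the $\mathrm{Reg}^n$ along the $L_z^n$; it acts in the Hilbert completion of $\bigcup_nH^n$. For $s\in S(n)$, $[s]$ is the number of cycles. The distinguished vector $\xi_0$ of $T_z$ ($z\ne0,\infty$)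 is the unit vector represented, in each $H^n$, by the function $F_z^n(x)=\left(\frac{n!}{t(t+1)\cdots(t+n-1)}\right)^{1/2}z^{[x]}$ (one has $L_z^nF_z^n=F_z^{n+1}$). For $z=\infty$ it is represented by $F_\infty^n=\sqrt{n!}\,\delta_e$ (up to a scalar factor of modulus 1). A vector is cyclic if the linear span of its $G$-orbit is dense. *)

(* Defs.v *)
From HB Require Import structures.
From mathcomp Require Import all_boot all_order all_algebra all_fingroup.
From mathcomp Require Import all_classical all_reals all_analysis.
From mathcomp Require Import complex.

Set Implicit Arguments.
Unset Strict Implicit.
Unset Printing Implicit Defensive.

Import Order.TTheory GRing.Theory Num.Theory.
Import numFieldNormedType.Exports.

Local Open Scope classical_set_scope.
Local Open Scope ring_scope.

HB.mixin Record CompleteNormed_isHilbert (R : realType) (H : Type)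
    & CompleteNormedModule R[i] H := {
  dotmul : {dot H for (@Num.conj R[i])};
  dotmul_norm : forall u : H, dotmul u u = `|u| ^+ 2
}.

#[short(type="hilbertType")]
HB.structure Definition Hilbert (R : realType) :=
  {H of CompleteNormed_isHilbert R H & CompleteNormedModule R[i] H}.

Definition finitary (s : nat -> nat) : Prop :=
  bijective s /\ exists n, forall i, (n <= i)%N -> s i = i.

Definition Sinf : Type := {s : nat -> nat | finitary s}.

HB.instance Definition _ := gen_eqMixin Sinf.
HB.instance Definition _ := gen_choiceMixin Sinf.

Lemma Sinf_eq (s t : Sinf) : sval s =1 sval t -> s = t.
Proof. by case: s t => [s ?] [t ?] /= st; apply: eq_exist; exact/funext. Qed.

Lemma finitary_id : finitary id.
Proof. by split; [exact: (Bijective (g := id)) | exists 0%N]. Qed.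

Lemma finitary_comp (s t : nat -> nat) :
  finitary s -> finitary t -> finitary (s \o t).
Proof.
move=> [bs [n sn]] [bt [m tm]]; split; first exact: bij_comp.
exists (maxn n m) => i; rewrite geq_max => /andP[ni mi] /=.
by rewrite tm// sn.
Qed.

Lemma finitary_inv (s : Sinf) :
  {t : nat -> nat | [/\ finitary t, cancel (sval s) t & cancel t (sval s)]}.
Proof.
apply: cid; case: s => s /= [[t st ts] [n sn]]; exists t; split=> //.
split; first by exists s.
by exists n => i ni; rewrite -{1}(sn i ni) st.
Qed.

Definition Sinf_one : Sinf := exist _ id finitary_id.
(* (s t)(i) = s (t i) *)
Definition Sinf_mul (s t : Sinf) : Sinf :=
  exist _ (sval s \o sval t) (finitary_comp (svalP s) (svalP t)).
Definition Sinf_inv (s : Sinf) : Sinf :=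
  let t := finitary_inv s in
  exist _ (sval t) (let: And3 ft _ _ := svalP t in ft).

Fact Sinf_mulA : associative Sinf_mul.
Proof. by move=> s t u; exact: Sinf_eq. Qed.
Fact Sinf_mul1 : left_id Sinf_one Sinf_mul.
Proof. by move=> s; exact: Sinf_eq. Qed.
Fact Sinf_mul1r : right_id Sinf_one Sinf_mul.
Proof. by move=> s; exact: Sinf_eq. Qed.
Fact Sinf_mulV : left_inverse Sinf_one Sinf_inv Sinf_mul.
Proof.
by move=> s; apply: Sinf_eq => i /=; case: finitary_inv => t /= [_ + _]; exact.
Qed.
Fact Sinf_mulVr : right_inverse Sinf_one Sinf_inv Sinf_mul.
Proof.
by move=> s; apply: Sinf_eq => i /=; case: finitary_inv => t /= [_ _]; exact.
Qed.

HB.instance Definition _ :=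
  isGroup.Build Sinf Sinf_mulA Sinf_mul1 Sinf_mul1r Sinf_mulV Sinf_mulVr.

Definition ext_perm n (s : 'S_n) (i : nat) : nat :=
  if insub i is Some j then val (s j) else i.

Lemma ext_permE n (s : 'S_n) (i : 'I_n) : ext_perm s i = s i.
Proof. by rewrite /ext_perm valK. Qed.

Lemma ext_perm_id n (s : 'S_n) (i : nat) : (n <= i)%N -> ext_perm s i = i.
Proof. by move=> ni; rewrite /ext_perm insubF// ltnNge ni. Qed.

Lemma ext_permK n (s t : 'S_n) : cancel s t -> cancel (ext_perm s) (ext_perm t).
Proof.
move=> st i; case: (ltnP i n) => [i_n | ni]; last by rewrite !ext_perm_id.
by have -> : i = Ordinal i_n by []; rewrite !ext_permE st.
Qed.

Lemma finitary_ext_perm n (s : 'S_n) : finitary (ext_perm s).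
Proof.
split; last by exists n => i; exact: ext_perm_id.
exists (ext_perm s^-1%g); apply: ext_permK => i; first by rewrite permK.
by rewrite permKV.
Qed.

(* S(n), acting on {0, ..., n-1}, as the subgroup of S(oo) fixing every i >= n *)
Definition Sinf_of n (s : 'S_n) : Sinf := exist _ (ext_perm s) (finitary_ext_perm s).

Lemma Sinf_union (u : Sinf) : exists n (s : 'S_n), u = Sinf_of s.
Proof.
case: u => u [bu [n un]]; exists n.
have ltu (i : 'I_n) : (u i < n)%N.
  rewrite ltnNge; apply/negP => ni; have /(bij_inj bu) ui := un _ ni.
  by move: ni; rewrite ui leqNgt ltn_ord.
have inju : injective (fun i : 'I_n => Ordinal (ltu i)).
  by move=> i j [] /(bij_inj bu) /val_inj.
exists (perm inju); apply: Sinf_eq => i /=.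
case: (ltnP i n) => [i_n | ni]; last by rewrite ext_perm_id ?un.
by have -> : i = Ordinal i_n by []; rewrite ext_permE permE.
Qed.

Notation Ginf := (Sinf * Sinf)%type.

Definition Ginf_of n (g : 'S_n * 'S_n) : Ginf := (Sinf_of g.1, Sinf_of g.2).

Definition perm_proj_fun n (x : 'S_n.+1) (i : 'I_n) : 'I_n :=
  if unlift ord_max (x (lift ord_max i)) is Some j then j
  else odflt i (unlift ord_max (x ord_max)).

Lemma lift_perm_proj_fun n (x : 'S_n.+1) (i : 'I_n) :
  lift ord_max (perm_proj_fun x i) = tperm ord_max (x ord_max) (x (lift ord_max i)).
Proof.
rewrite /perm_proj_fun; case: unliftP => [j xi|xi].
  rewrite tpermD ?xi ?neq_lift//; apply: contraTneq (neq_lift ord_max i).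
  by rewrite -xi => /perm_inj <-; rewrite eqxx.
rewrite xi tpermL; case: unliftP => [j xm|xm] /=; first by rewrite xm.
by move: (neq_lift ord_max i); rewrite -(inj_eq (@perm_inj _ x)) xi xm eqxx.
Qed.

Lemma perm_proj_fun_inj n (x : 'S_n.+1) : injective (perm_proj_fun x).
Proof.
move=> i j /(congr1 (lift ord_max)); rewrite !lift_perm_proj_fun.
by move/perm_inj/perm_inj/lift_inj.
Qed.

(* Removes the last point from its cycle. *)
Definition perm_proj n (x : 'S_n.+1) : 'S_n := perm (@perm_proj_fun_inj n x).

Lemma lift_perm_proj n (x : 'S_n.+1) :
  lift_perm ord_max ord_max (perm_proj x) = (x * tperm ord_max (x ord_max))%g.
Proof.
apply/permP => i; rewrite permM; case: (unliftP ord_max i) => [j ->|->].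
  by rewrite lift_perm_lift permE lift_perm_proj_fun.
by rewrite lift_perm_id tpermR.
Qed.

Lemma lift_perm_maxK n : cancel (@lift_perm n ord_max ord_max) (@perm_proj n).
Proof.
move=> s; apply/permP => i; apply: (@lift_inj _ ord_max).
by rewrite permE lift_perm_proj_fun lift_perm_id tperm1 perm1 lift_perm_lift.
Qed.

Definition cycles n (s : 'S_n) : nat := #|porbits s|.

Section RegularRepresentations.
Context {R : realType}.
Local Notation C := R[i].

Definition L2S n := {ffun 'S_n -> C^o}.

Definition L2S_dot n (f g : L2S n) : C :=
  (n`!%:R)^-1 * \sum_(x : 'S_n) f x * (g x)^*.

(* f(g_2^-1 x g_1): the product of permutations in the library is read from
   left to right. *)
Definition Reg n (g : 'S_n * 'S_n) (f : L2S n) : L2S n :=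
  [ffun x => f (g.1 * x * g.2^-1)%g].

(* None is the point at infinity; the points of S(n) in S(n+1) are the
   permutations fixing ord_max, and perm_proj restricts such a permutation. *)
Definition embL (z : option C) n (f : L2S n) : L2S n.+1 :=
  match z with
  | Some z =>
      [ffun x : 'S_n.+1 =>
        if x ord_max == ord_max
        then z * sqrtC (n.+1%:R / (`|z| ^+ 2 + n%:R)) * f (perm_proj x)
        else sqrtC (n.+1%:R / (`|z| ^+ 2 + n%:R)) * f (perm_proj x)]
  | None =>
      [ffun x : 'S_n.+1 =>
        if x ord_max == ord_max then sqrtC n.+1%:R * f (perm_proj x) else 0]
  end.

Definition distF (z : option C) n : L2S n :=
  match z with
  | Some z =>
      [ffun x : 'S_n =>
        sqrtC (n`!%:R / \prod_(k < n) (`|z| ^+ 2 + k%:R)) * z ^+ cycles x]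
  | None => [ffun x : 'S_n => if x == 1%g then sqrtC n`!%:R else 0]
  end.

(* A realization of T_z: a Hilbert space with compatible isometric embeddings
   of the H^n, n >= 1, whose images have dense union, and a unitary
   representation of G extending the Reg^n. It is unique up to a unique unitary
   equivalence. *)
Record gen_regular_rep (z : option C) (H : hilbertType R) := GenRegularRep {
  rr_emb : forall n, {linear L2S n -> H};
  rr_emb_isometry : forall n, (0 < n)%N ->
    forall f g : L2S n, dotmul (rr_emb n f) (rr_emb n g) = L2S_dot f g;
  rr_emb_embL : forall n, (0 < n)%N ->
    forall f : L2S n, rr_emb n.+1 (embL z f) = rr_emb n f;
  rr_emb_dense : dense (\bigcup_(n in [set n | (0 < n)%N]) range (rr_emb n));
  rr_act : Ginf -> {linear H -> H};
  rr_act_unitary : forall g (u v : H), dotmul (rr_act g u) (rr_act g v) = dotmul u v;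
  rr_act_one : forall u : H, rr_act 1%g u = u;
  rr_act_mul : forall (g h : Ginf) (u : H), rr_act (g * h)%g u = rr_act g (rr_act h u);
  rr_act_emb : forall n, (0 < n)%N -> forall (g : 'S_n * 'S_n) (f : L2S n),
    rr_act (Ginf_of g) (rr_emb n f) = rr_emb n (Reg g f)
}.

Definition distinguished z H (T : gen_regular_rep z H) : H :=
  rr_emb T 1 (distF z 1).

Definition lin_span (H : lmodType C) (S : set H) : set H :=
  [set v | exists m (c : 'I_m -> C) (w : 'I_m -> H),
     (forall k, S (w k)) /\ v = \sum_(k < m) c k *: w k].

Definition cyclic_vector z H (T : gen_regular_rep z H) (xi : H) : Prop :=
  dense (lin_span (range (fun g : Ginf => rr_act T g xi))).

End RegularRepresentations.

Lemma cycles_lift_perm n (s : 'S_n) :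
  cycles (lift_perm ord_max ord_max s) = (cycles s).+1.
Proof.
set t := lift_perm _ _ _.
have lift_iter k i : (t ^+ k)%g (lift ord_max i) = lift ord_max ((s ^+ k)%g i).
  elim: k i => [|k IHk] i; first by rewrite !expg0 !perm1.
  by rewrite !expgS !permM lift_perm_lift IHk.
have max_iter k : (t ^+ k)%g ord_max = ord_max.
  by elim: k => [|k IHk]; rewrite ?perm1// expgS permM lift_perm_id.
have porbit_lift i :
    porbit t (lift ord_max i) = [set lift ord_max j | j in porbit s i]%SET.
  apply/setP => j; apply/porbitP/imsetP => [[k ->]|[_ /porbitP[k ->] ->]].
    by exists ((s ^+ k)%g i); rewrite ?mem_porbit// lift_iter.
  by exists k; rewrite lift_iter.
have porbit_max : porbit t ord_max = [set ord_max]%SET.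
  apply/setP => j; rewrite finset.in_set1; apply/porbitP/eqP => [[k ->]|->].
    by rewrite max_iter.
  by exists 0%N; rewrite perm1.
have -> : cycles t =
    #|[set ord_max]%SET |: [set [set lift ord_max j | j in A]%SET
                            | A : {set 'I_n} in porbits s]%SET|.
  congr #|pred_of_set _|; apply/setP => B; rewrite finset.in_setU1.
  apply/imsetP/orP => [[i _ ->]|[/eqP->|/imsetP[_ /imsetP[i _ ->] ->]]].
  - case: (unliftP ord_max i) => [j|] ->; last by left; rewrite porbit_max.
    by right; apply/imsetP; exists (porbit s j); rewrite ?imset_f// porbit_lift.
  - by exists ord_max; rewrite ?porbit_max.
  - by exists (lift ord_max i); rewrite ?porbit_lift.
rewrite cardsU1 card_imset; last exact/imset_inj/lift_inj.
rewrite (_ : _ \notin _)//; apply/imsetP => -[A _ /setP/(_ ord_max)].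
rewrite finset.in_set1 eqxx => /esym/imsetP[j _ /eqP].
by rewrite (negPf (neq_lift _ _)).
Qed.

Lemma cycles_proj n (x : 'S_n.+1) :
  cycles x = (cycles (perm_proj x) + (x ord_max == ord_max))%N.
Proof.
set y := (x^-1)%g ord_max.
have xy : x y = ord_max by rewrite permKV.
have lx : lift_perm ord_max ord_max (perm_proj x) = (tperm y ord_max * x)%g.
  rewrite lift_perm_proj.
  have -> : tperm ord_max (x ord_max) = (tperm y ord_max ^ x)%g.
    by rewrite tpermJ xy.
  by rewrite conjgE mulKVg.
have := porbits_mul_tperm x y ord_max.
rewrite /= -lx -/(cycles _) cycles_lift_perm -/(cycles x).
have -> : y \in porbit x ord_max.
  by rewrite porbit_sym -xy; apply/porbitP; exists 1%N; rewrite expg1.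
have -> : (x ord_max == ord_max) = (y == ord_max).
  by rewrite -(inj_eq (@perm_inj _ x) y) xy eq_sym.
by rewrite addn0; case: eqVneq => _ /=; rewrite ?addn0 ?addn1; [move=> -> | case].
Qed.

Section Compatibility.
Context {R : realType}.
Local Notation C := R[i].

Lemma embL_distF (z : option C) n :
  (z != Some 0) -> embL z (distF z n) = distF z n.+1.
Proof.
case: z => [z|] z0; apply/ffunP => x; rewrite !ffunE.
  have t0 : 0 < `|z| ^+ 2 by rewrite exprn_gt0// normr_gt0.
  have tn0 k : 0 < `|z| ^+ 2 + k%:R by rewrite ltr_wpDr.
  have P0 : 0 <= \prod_(k < n) (`|z| ^+ 2 + k%:R).
    by apply: prodr_ge0 => k _; exact/ltW.
  rewrite big_ord_recr/= factS natrM cycles_proj.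
  set c := sqrtC (n.+1%:R / _); set d := sqrtC (n`!%:R / _).
  have -> : sqrtC (n.+1%:R * n`!%:R /
      (\prod_(k < n) (`|z| ^+ 2 + k%:R) * (`|z| ^+ 2 + n%:R))) = c * d.
    rewrite -sqrtCM ?nnegrE ?divr_ge0// ?ltW//.
    by rewrite [X in _ / X]mulrC mulf_div.
  case: ifP => _; rewrite ?addn0 ?addn1 ?exprS; last by rewrite mulrA.
  by rewrite [z * c]mulrC mulrACA.
rewrite factS natrM sqrtCM ?nnegrE//; case: ifP => [/eqP xm|xm].
  have -> : (perm_proj x == 1%g) = (x == 1%g); last by case: ifP => _; rewrite ?mulr0.
  apply/eqP/eqP => [p1|->].
    by have := lift_perm_proj x; rewrite xm tperm1 mulg1 p1 lift_perm1.
  apply: (can_inj (@lift_perm_maxK n)).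
  by rewrite lift_perm_proj perm1 !tperm1 mulg1 lift_perm1.
by case: eqP => // x1; rewrite x1 perm1 eqxx in xm.
Qed.

Lemma distinguishedE (z : option C) (H : hilbertType R)
    (T : gen_regular_rep z H) n : z != Some 0 -> (0 < n)%N ->
  distinguished T = rr_emb T n (distF z n).
Proof.
move=> z0; elim: n => // -[|n] IHn _ //.
by rewrite (IHn erefl) -[in RHS]embL_distF// rr_emb_embL.
Qed.

Lemma Reg_perm_proj n (g : 'S_n * 'S_n) (x : 'S_n.+1) :
  perm_proj (lift_perm ord_max ord_max g.1 * x *
             (lift_perm ord_max ord_max g.2)^-1)%g =
  (g.1 * perm_proj x * g.2^-1)%g.
Proof.
apply: (can_inj (@lift_perm_maxK n)).
rewrite lift_perm_proj -!(lift_permM _ ord_max) lift_perm_proj -lift_permV.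
set h := lift_perm _ _ g.2; have hm : (h^-1)%g ord_max = ord_max.
  by rewrite lift_permV lift_perm_id.
rewrite !permM lift_perm_id -!mulgA; congr (_ * (_ * _))%g.
by rewrite -{1}hm -tpermJ conjgE invgK !mulgA mulVg mul1g.
Qed.

Lemma embL_Reg (z : option C) n (g : 'S_n * 'S_n) (f : L2S (R := R) n) :
  embL z (Reg g f) = Reg (lift_perm ord_max ord_max g.1,
                          lift_perm ord_max ord_max g.2) (embL z f).
Proof.
case: z => [z|]; apply/ffunP => x; rewrite !ffunE/= Reg_perm_proj !permM;
  rewrite lift_perm_id; set h := lift_perm _ _ g.2;
  have -> : ((h^-1)%g (x ord_max) == ord_max) = (x ord_max == ord_max); do ?by [];
  by rewrite -(inj_eq (@perm_inj _ h)) permKV lift_perm_id.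
Qed.

Lemma sum_perm_proj n (F : 'S_n.+1 -> C) :
  \sum_x F x = \sum_(s : 'S_n) \sum_(j : 'I_n.+1)
    F (lift_perm ord_max ord_max s * tperm ord_max j)%g.
Proof.
pose h (p : 'S_n * 'I_n.+1) :=
  (lift_perm ord_max ord_max p.1 * tperm ord_max p.2)%g.
rewrite pair_big/= (reindex_onto h (fun x => (perm_proj x, x ord_max))) /=.
  apply: eq_bigl => -[s j]; rewrite /h/= !permM lift_perm_id tpermL.
  apply/eqP; congr (_, _); apply: (can_inj (@lift_perm_maxK n)).
  by rewrite lift_perm_proj !permM lift_perm_id tpermL -mulgA tperm2 mulg1.
by move=> x _; rewrite /h/= lift_perm_proj -mulgA tperm2 mulg1.
Qed.

Lemma embL_isometry (z : option C) n (f g : L2S (R := R) n) :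
  (z != Some 0) || (0 < n)%N ->
  L2S_dot (embL z f) (embL z g) = L2S_dot f g.
Proof.
move=> zn.
have projE s (j : 'I_n.+1) :
    perm_proj (lift_perm ord_max ord_max s * tperm ord_max j)%g = s.
  apply: (can_inj (@lift_perm_maxK n)).
  by rewrite lift_perm_proj !permM lift_perm_id tpermL -mulgA tperm2 mulg1.
have maxE (s : 'S_n) (j : 'I_n.+1) :
    (lift_perm ord_max ord_max s * tperm ord_max j)%g ord_max = j.
  by rewrite permM lift_perm_id tpermL.
have sqrtC2 (a : C) : 0 <= a -> sqrtC a * (sqrtC a)^* = a.
  move=> a0; rewrite (CrealP _) ?ger0_real ?sqrtC_ge0//.
  by rewrite -expr2 sqrtCK.
rewrite /L2S_dot sum_perm_proj factS natrM invfM -mulrA mulrCA; congr (_ * _).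
rewrite mulr_sumr; apply: eq_bigr => s _.
rewrite big_ord_recr/=.
case: z zn => [z|] zn.
  have tn0 : 0 < `|z| ^+ 2 + n%:R.
    move: zn; case: eqVneq => [[->]|z0] /=.
      by rewrite normr0 expr0n/= add0r ltr0n.
    rewrite ltr_wpDr// exprn_gt0// normr_gt0.
    by apply: contra_neq z0 => ->.
  pose c : C := n.+1%:R / (`|z| ^+ 2 + n%:R).
  have c0 : 0 <= c by rewrite divr_ge0// ltW.
  have offE (u : L2S n) (i : 'I_n) : embL (Some z) u
      (lift_perm ord_max ord_max s * tperm ord_max (widen_ord (leqnSn n) i))%g =
      sqrtC c * u s.
    by rewrite !ffunE maxE projE -val_eqE/= (ltn_eqF (ltn_ord i)).
  have onE (u : L2S n) : embL (Some z) u
      (lift_perm ord_max ord_max s * tperm ord_max ord_max)%g =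
      z * (sqrtC c * u s).
    by rewrite !ffunE maxE projE eqxx mulrA.
  have normE : sqrtC c * f s * (sqrtC c * g s)^* = c * (f s * (g s)^*).
    by rewrite rmorphM/= mulrACA sqrtC2.
  rewrite !onE rmorphM/= mulrACA -normCK normE.
  under eq_bigr => i _ do rewrite !offE normE.
  set w := f s * _; have cE : (n%:R + `|z| ^+ 2) * c = n.+1%:R.
    by rewrite /c addrC mulrC divfK ?gt_eqF.
  rewrite sumr_const card_ord -[X in X + _]mulr_natl -mulrDl [X in _ * X]mulrA.
  by rewrite cE mulrA mulVf ?mul1r// pnatr_eq0.
have offE (u : L2S n) (i : 'I_n) : embL None u
    (lift_perm ord_max ord_max s * tperm ord_max (widen_ord (leqnSn n) i))%g = 0.
  by rewrite !ffunE maxE -val_eqE/= (ltn_eqF (ltn_ord i)).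
have onE (u : L2S n) : embL None u
    (lift_perm ord_max ord_max s * tperm ord_max ord_max)%g =
    sqrtC n.+1%:R * u s.
  by rewrite !ffunE maxE projE eqxx.
rewrite !onE big1 => [|i _]; last by rewrite offE mul0r.
rewrite add0r rmorphM/= mulrACA sqrtC2 ?ler0n//.
by rewrite mulKf.
Qed.

End Compatibility.

(* Main.v *)
From HB Require Import structures.
Require Import Defs.
From mathcomp Require Import all_boot all_order all_algebra all_fingroup.
From mathcomp Require Import all_classical all_reals all_analysis.
From mathcomp Require Import complex.

Set Implicit Arguments.
Unset Strict Implicit.
Unset Printing Implicit Defensive.

(** Every [H^n] lies in the span of the orbit of the distinguished vector, by
    induction on [n]; density of the union of the [H^n] then gives cyclicity.
    Write [d] for the delta function at the identity.

    [H^1] is the line through the distinguished vector. Suppose that [H^n] lies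
    in that span. Then so does the image of [d] in [H^(n+1)], and so do all its
    translates. For [z = oo] this image is a multiple of the delta function at
    the identity of [S(n+1)], whose translates span. For finite [z] it is, up to
    a nonzero factor, [z d + J d], where [J] is the last Jucys-Murphy element of
    [S(n+1)], the sum of the transpositions moving the last point: a permutation
    that projects to the identity is the identity or such a transposition
    ([embL_delta_id]). The translates of [z d + J d] by one factor of the group
    span the range of the operator [z + J] ([Reg_generate]), so it is enough
    that [z + J] be surjective on functions on [S(n+1)], or, in finite
    dimension, injective.

    Injectivity for nonintegral [z] is the classical fact that Jucys-Murphy
    elements have integral eigenvalues ([jucys_murphy_spectrum]). It follows by
    induction along the chain of Jucys-Murphy elements from two relations: two
    consecutive ones [J], [J'] commute, and with the adjacent transposition [s]
    they satisfy the degenerate Hecke relation [J s = s J' - 1]. On a nonzero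
    eigenspace of [J'] for a nonintegral [a], these would force
    [(J - a)^2 = 1], making [a - 1] or [a + 1] a nonintegral eigenvalue of [J]
    ([integral_spectrum_step]). *)

Import Order.TTheory GRing.Theory Num.Theory.

Local Open Scope ring_scope.

(** * Eigenvalues of the Jucys-Murphy elements *)

(** Phrased as an absence of eigenvectors for nonintegral scalars, so as to make
    sense without diagonalizability or algebraic closedness. *)
Definition integral_spectrum (K : fieldType) (V : lmodType K) (J : V -> V) :=
  forall a : K, (forall m : int, a <> m%:~R) ->
  forall v, J v = a *: v -> v = 0.

(** With [E] the eigenspace of [J'] for a nonintegral [a] and [B = J - a], the
    relation [J s = s J' - 1] reads [B s = - 1] on [E], and [B] preserves [E]
    because [J] and [J'] commute. As [B] is injective, [s B = - 1] on [E] too,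
    and then [s^2 = 1] yields [B^2 = 1] on [E]. Since [a - 1] and [a + 1] are
    not integers, [B + 1] and [B - 1] are injective as well, hence [E = 0]. *)
Lemma integral_spectrum_step (K : fieldType) (V : lmodType K)
    (J J' s : {linear V -> V}) :
  involutive s -> (forall v, J (J' v) = J' (J v)) ->
  (forall v, J (s v) = s (J' v) - v) ->
  integral_spectrum J -> integral_spectrum J'.
Proof.
move=> sK JJ' Js specJ a aN v J'v.
have aN1 (e m : int) : a + e%:~R <> m%:~R.
  by move=> /(canRL (addrK _)); rewrite -intrB; exact: aN.
pose B u := J u - a *: u.
have BE u b : B u = b *: u -> J u = (a + b) *: u.
  by move/(canRL (subrK _)) ->; rewrite scalerDl addrC.
have BD u w : B (u + w) = B u + B w.
  by rewrite /B linearD scalerDr opprD addrACA.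
have BN u : B (- u) = - B u by rewrite /B linearN scalerN opprD.
have Bs u : J' u = a *: u -> B (s u) = - u.
  by move=> J'u; rewrite /B Js J'u linearZ/= addrAC subrr add0r.
have J'Bv : J' (B v) = a *: B v.
  by rewrite /B linearB linearZ/= -JJ' J'v linearZ scalerBr.
have sBv : s (B v) = - v.
  apply/eqP; rewrite -addr_eq0; apply/eqP/(specJ a) => //; apply/eqP.
  by rewrite -subr_eq0 -/(B _) BD Bs // addNr.
have Bv : B v = - s v by rewrite -[LHS]sK sBv linearN.
have BBv : B (B v) = v by rewrite {1}Bv BN Bs// opprK.
clearbody B.
have Bv_v : B v - v = 0.
  apply: (specJ (a + (-1)%:~R)); first exact: aN1.
  by apply: BE; rewrite BD BN BBv scaleN1r opprB.
apply: (specJ (a + 1%:~R)); first exact: aN1.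
by apply: BE; rewrite scale1r; apply/eqP; rewrite -subr_eq0 Bv_v.
Qed.

Section JucysMurphy.
Context {K : fieldType} {n : nat}.
Local Notation V := {ffun 'S_n -> K^o}.
Implicit Types (f : V) (k : 'I_n).

Definition translate (g : 'S_n) f : V := [ffun x => f (g * x)%g].

Fact translate_linear g : linear (translate g).
Proof. by move=> a f h; apply/ffunP => x; rewrite !ffunE. Qed.
HB.instance Definition _ g :=
  GRing.isLinear.Build K V V _ (translate g) (translate_linear g).

Definition jucys_murphy k f : V :=
  [ffun x => \sum_(j < n | (j < k)%N) f (tperm j k * x)%g].

Fact jucys_murphy_linear k : linear (jucys_murphy k).
Proof.
move=> a f h; apply/ffunP => x; rewrite !ffunE scaler_sumr -big_split/=.
by apply: eq_bigr => j _; rewrite !ffunE.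
Qed.
HB.instance Definition _ k :=
  GRing.isLinear.Build K V V _ (jucys_murphy k) (jucys_murphy_linear k).

(** Conjugation by a transposition of points up to [k] fixes [k'] and permutes
    the points below [k'], so it only permutes the terms of the larger
    Jucys-Murphy element. *)
Lemma jucys_murphy_comm (k k' : 'I_n) f : (k < k')%N ->
  jucys_murphy k (jucys_murphy k' f) = jucys_murphy k' (jucys_murphy k f).
Proof.
move=> kk'; apply/ffunP => x; rewrite !ffunE.
transitivity (\sum_(j < n | (j < k)%N) \sum_(i < n | (i < k')%N)
    f (tperm j k * (tperm i k' * x))%g); last first.
  by rewrite exchange_big/=; apply: eq_bigr => i _; rewrite ffunE.
apply: eq_bigr => j jk; rewrite ffunE.
have fix_k' : tperm j k k' = k'.
  by rewrite tpermD// -val_eqE/= ltn_eqF// (ltn_trans jk).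
rewrite (reindex_inj (@perm_inj _ (tperm j k))) /=.
apply: eq_big => [i|i _].
  by case: tpermP => [-> | -> |//]; rewrite kk' (ltn_trans jk kk').
rewrite !mulgA; congr (f (_ * _)%g).
by rewrite -{1}fix_k' -tpermJ conjgE tpermV -!mulgA tperm2 mulg1.
Qed.

(** The degenerate Hecke relation: conjugation by the adjacent transposition
    turns the terms of the smaller Jucys-Murphy element into those of the next
    one, except for the adjacent transposition itself, which accounts for
    [- f]. *)
Lemma jucys_murphy_translate (k k' : 'I_n) f : k' = k.+1 :> nat ->
  jucys_murphy k (translate (tperm k k') f) =
  translate (tperm k k') (jucys_murphy k' f) - f.
Proof.
move=> k'E; apply/ffunP => x; rewrite !ffunE.
rewrite [in RHS](bigD1 k)/= ?k'E// mulgA tperm2 mul1g addrAC subrr add0r.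
apply: eq_big => [j|j jk]; first by rewrite ltnS ltn_neqAle andbC.
rewrite ffunE !mulgA; congr (f (_ * _)%g).
have -> : tperm j k' = (tperm j k ^ tperm k k')%g.
  by rewrite tpermJ tpermL tpermD// -val_eqE/= ?k'E gtn_eqF// ltnW.
by rewrite conjgE tpermV -!mulgA tperm2 mulg1.
Qed.

Lemma jucys_murphy_spectrum k : integral_spectrum (jucys_murphy k).
Proof.
case: k => k; elim: k => [|k IHk] ltkn.
  (* The first Jucys-Murphy element is an empty sum. *)
  move=> a aN f Jf; apply/eqP; move: Jf.
  have -> : jucys_murphy (Ordinal ltkn) f = 0.
    by apply/ffunP => x; rewrite !ffunE big_pred0.
  move/esym/eqP; rewrite scaler_eq0 => /orP[/eqP a0|//].
  by case: (aN 0); rewrite a0.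
pose k0 := Ordinal (ltnW ltkn); pose k1 := Ordinal ltkn.
apply: (@integral_spectrum_step _ _ (jucys_murphy k0) _
          (translate (tperm k0 k1))).
- by move=> f; apply/ffunP => x; rewrite !ffunE mulgA tperm2 mul1g.
- by move=> f; apply: jucys_murphy_comm.
- by move=> f; apply: jucys_murphy_translate.
- exact: IHk.
Qed.

Lemma jucys_murphy_surj k (a : K) : (forall m : int, a <> m%:~R) ->
  forall f, exists h, a *: h + jucys_murphy k h = f.
Proof.
move=> aN f.
pose D := (a *: \1 + linfun (jucys_murphy k))%VF.
have DE h : D h = a *: h + jucys_murphy k h.
  by rewrite add_lfunE scale_lfunE id_lfunE lfunE.
have D0 : lker D == 0%VS.
  apply/lker0P => h h' /eqP; rewrite -subr_eq0 -linearB/= DE addrC addr_eq0.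
  move/eqP; rewrite -scaleNr => /jucys_murphy_spectrum e.
  apply/eqP; rewrite -subr_eq0; apply/eqP/e => m am.
  by apply: (aN (- m)); rewrite mulrNz -am opprK.
by exists (D^-1%VF f); rewrite -DE lker0_lfunVK.
Qed.

End JucysMurphy.

(** * Linear spans *)

Section LinSpan.
Context {R : realType} {H : lmodType R[i]}.
Implicit Types S : set H.

Lemma lin_span_gen S v : S v -> lin_span S v.
Proof.
move=> Sv; exists 1%N, (fun=> 1), (fun=> v); split=> //.
by rewrite big_ord1 scale1r.
Qed.

Lemma lin_span0 S : lin_span S 0.
Proof.
exists 0%N, (fun=> 0), (fun=> 0); split; first by case.
by rewrite big_ord0.
Qed.

Lemma lin_spanD S u v : lin_span S u -> lin_span S v -> lin_span S (u + v).
Proof.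
move=> [m [c [w [Sw ->]]]] [m' [c' [w' [Sw' ->]]]].
pose glue T (a : 'I_m -> T) (a' : 'I_m' -> T) (k : 'I_(m + m')) :=
  match fintype.split k with inl i => a i | inr i => a' i end.
exists (m + m')%N, (glue _ c c'), (glue _ w w'); split.
  by move=> k; rewrite /glue; case: fintype.split.
rewrite big_split_ord/=; congr (_ + _); apply: eq_bigr => i _; rewrite /glue.
  by rewrite (unsplitK (inl i)).
by rewrite (unsplitK (inr i)).
Qed.

Lemma lin_spanZ S a v : lin_span S v -> lin_span S (a *: v).
Proof.
move=> [m [c [w [Sw ->]]]]; exists m, (fun k => a * c k), w; split=> //.
by rewrite scaler_sumr; apply: eq_bigr => k _; rewrite scalerA.
Qed.

Lemma lin_span_sum S (I : finType) (F : I -> H) :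
  (forall i, lin_span S (F i)) -> lin_span S (\sum_i F i).
Proof.
by move=> SF; apply: big_ind => //; [exact: lin_span0 | exact: lin_spanD].
Qed.

Lemma lin_span_stable S (A : {linear H -> H}) :
  (forall v, S v -> S (A v)) -> forall v, lin_span S v -> lin_span S (A v).
Proof.
move=> SA _ [m [c [w [Sw ->]]]]; exists m, c, (A \o w); split=> [k|].
  exact/SA/Sw.
by rewrite linear_sum; apply: eq_bigr => k _; rewrite linearZ.
Qed.

End LinSpan.

(** * Each level is generated by the image of the previous one *)

Section Generation.
Context {R : realType}.
Local Notation C := R[i].

Definition delta_id n : L2S (R := R) n := [ffun x => (x == 1%g)%:R].

Lemma perm_proj_eq1 n (x : 'S_n.+1) :
  (perm_proj x == 1%g) = (x == tperm ord_max (x ord_max)).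
Proof.
apply/eqP/eqP => [p1|xt]; last first.
  apply: (can_inj (@lift_perm_maxK n)).
  by rewrite lift_perm_proj {1}xt tperm2 lift_perm1.
have := lift_perm_proj x; rewrite p1 lift_perm1 => /esym/(canRL (mulgK _)).
by rewrite mul1g tpermV.
Qed.

(** The image of the delta function at the identity of [S(n)] is, up to a scalar,
    [z] plus the last Jucys-Murphy element, as an element of the group algebra
    of [S(n+1)]: this is how the spectrum of that element enters. *)
Lemma embL_delta_id (z : C) n (y : 'S_n.+1) :
  embL (Some z) (delta_id n) y =
  sqrtC (n.+1%:R / (`|z| ^+ 2 + n%:R)) *
    (z * (y == 1%g)%:R
     + \sum_(j < n.+1 | (j < n)%N) (y == tperm j ord_max)%:R).
Proof.
rewrite !ffunE perm_proj_eq1; set c := sqrtC _.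
have [ym|ym] := eqVneq (y ord_max) ord_max.
  rewrite ym tperm1 big1 => [|j jn]; first by rewrite addr0 mulrCA mulrA.
  case: (y =P _) => [yE|//].
  by move: ym jn; rewrite yE tpermR => -> /=; rewrite ltnn.
have ymn : (y ord_max < n)%N.
  by rewrite ltn_neqAle -ltnS ltn_ord andbT.
rewrite (bigD1 (y ord_max))//= big1 => [|j /andP[_ jy]].
  have -> : (y == 1%g) = false.
    by apply: contraNF ym => /eqP ->; rewrite perm1.
  by rewrite mulr0 add0r addr0 tpermC.
case: (y =P _) => [yE|//].
by move: jy; rewrite yE tpermR eqxx.
Qed.

Lemma embL_infty_delta_id n (y : 'S_n.+1) :
  embL None (delta_id n) y = sqrtC n.+1%:R * (y == 1%g)%:R.
Proof.
rewrite !ffunE perm_proj_eq1; have [ym|ym] := eqVneq (y ord_max) ord_max.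
  by rewrite ym tperm1.
have -> : (y == 1%g) = false.
  by apply: contraNF ym => /eqP ->; rewrite perm1.
by rewrite mulr0.
Qed.

Lemma sum_translates_delta n (h : L2S (R := R) n) (x t : 'S_n) :
  \sum_g h g * (x * g^-1 == t)%g%:R = h (t^-1 * x)%g.
Proof.
rewrite (bigD1 (t^-1 * x)%g)//= big1 => [|g gx].
  by rewrite invMg invgK mulKVg eqxx mulr1 addr0.
case: eqP => [xg|_]; last by rewrite mulr0.
by case/eqP: gx; rewrite -xg invMg invgK mulgKV.
Qed.

(** Translates by the second factor suffice. For finite [z], weighting them by
    [h] amounts to applying to [h] the operator [z + J] of [jucys_murphy_surj],
    up to the scalar [c]. The unknown [h] is thus a preimage of [f] by a surjection. *)
Lemma Reg_generate (z : option C) n (f : L2S n.+1) :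
  (forall k : int, z <> Some (k%:~R)) ->
  exists h : L2S n.+1,
    f = \sum_g h g *: Reg (1%g, g) (embL z (delta_id n)).
Proof.
have evalE (phi h : L2S n.+1) x :
    (\sum_g h g *: Reg (1%g, g) phi) x = \sum_g h g * phi (x * g^-1)%g.
  by rewrite sum_ffunE; apply: eq_bigr => g _; rewrite !ffunE/= mul1g.
case: z => [z|] zN; last first.
  have c0 : sqrtC n.+1%:R != 0 :> C by rewrite sqrtC_eq0 pnatr_eq0.
  exists ((sqrtC n.+1%:R)^-1 *: f); apply/ffunP => x; rewrite evalE.
  under eq_bigr => g _ do rewrite embL_infty_delta_id mulrCA.
  by rewrite -mulr_sumr sum_translates_delta invg1 mul1g ffunE mulVKf.
set c := sqrtC (n.+1%:R / (`|z| ^+ 2 + n%:R)).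
have c0 : c != 0.
  have z0 : z != 0 by apply/eqP => z0; apply: (zN 0); rewrite z0.
  rewrite sqrtC_eq0 mulf_neq0 ?pnatr_eq0// invr_eq0 gt_eqF//.
  by rewrite ltr_wpDr// exprn_gt0// normr_gt0.
have [|h hf] := @jucys_murphy_surj _ n.+1 ord_max z _ (c^-1 *: f).
  by move=> m zm; apply: (zN m); rewrite zm.
exists h; apply/ffunP => x; rewrite evalE.
have -> : f x = c * (z * h x + jucys_murphy ord_max h x).
  by have /(congr1 (fun u : L2S n.+1 => c * u x)) := hf; rewrite !ffunE mulVKf.
under eq_bigr => g _ do
  rewrite embL_delta_id -/c mulrCA mulrDr [h g * (z * _)]mulrCA mulr_sumr.
rewrite -mulr_sumr big_split/= -mulr_sumr sum_translates_delta invg1 mul1g.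
rewrite exchange_big/= ffunE; congr (_ * (_ + _)); apply: eq_bigr => j _.
by rewrite sum_translates_delta tpermV.
Qed.

End Generation.

(** * Cyclicity of the distinguished vector *)

Theorem proposition4p4p1 (R : realType) (z : option R[i])
    (hz : forall k : int, z <> Some (k%:~R))
    (H : hilbertType R) (T : gen_regular_rep z H) :
  cyclic_vector T (distinguished T).
Proof.
set xi := distinguished T.
pose S := range (fun g : Ginf => rr_act T g xi).
have S_act g v : lin_span S v -> lin_span S (rr_act T g v).
  apply: lin_span_stable => _ [h _ <-].
  by exists (g * h)%g => //; rewrite rr_act_mul.
suff span n (f : L2S n) : (0 < n)%N -> lin_span S (rr_emb T n f).
  move=> O O0 Oo; have [v [Ov [n /= n0 [f _ fv]]]] := rr_emb_dense T O0 Oo.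
  by exists v; split=> //; rewrite -fv; exact: span.
elim: n f => // -[_ f _|n IHn f _].
  have S1 (x : 'S_1) : x = 1%g by apply/permP => i; rewrite !ord1.
  have F0 : distF z 1 1%g != 0.
    case: {+}z hz => [w|] wN; rewrite ffunE ?eqxx.
      have w0 : w != 0 by apply/eqP => w0; apply: (wN 0); rewrite w0.
      rewrite mulf_neq0 ?expf_neq0// sqrtC_eq0 big_ord1 addr0.
      by rewrite mulf_neq0 ?oner_eq0// invr_eq0 expf_neq0// normr_eq0.
    by rewrite sqrtC_eq0 pnatr_eq0.
  have -> : f = (f 1%g / distF z 1 1%g) *: distF z 1.
    by apply/ffunP => x; rewrite ffunE (S1 x) [RHS]divfK.
  rewrite linearZ; apply/lin_spanZ/lin_span_gen; exists 1%g => //.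
  exact: rr_act_one.
have [h ->] := Reg_generate f hz.
rewrite linear_sum; apply: lin_span_sum => g; rewrite linearZ; apply: lin_spanZ.
by rewrite -rr_act_emb//; apply: S_act; rewrite rr_emb_embL//; exact: IHn.
Qed.
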